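(* Let $\Bbbk$ be a field, let $G$ be a connected finite simple graph, and let $\mathcal{I}_G=\langle x_ix_j-y_iy_j:\{i,j\}\in E(G)\rangle\subseteq\Bbbk[x_i,y_i:i\in V(G)]$. Put $\mathcal{J}_G:=\mathcal{I}_G:\bigl(\prod_{i\in V(G)}x_iy_i\bigr)^\infty$. Then \[ \mathcal{J}_G=\langle x_ix_j-y_iy_j:\text{there is an odd }(i,j)\text{-walk in }G\rangle+\langle x_iy_j-y_jx_i... \rangle \] is to be read as follows: $\mathcal{J}_G$ is generated by all binomials $x_ix_j-y_iy_j$ for which there is an odd $(i,j)$-walk in $G$ (including $i=j$), together with all binomials $x_iy_j-x_jy_i$ for which there is an even $(i,j)$-walk in $G$.
   Context: A $(v,w)$-walk of length $r-1$ in $G$ is a sequence of vertices $v=i_1,i_2,\dots,i_r=w$ with $\{i_k,i_{k+1}\}\in E(G)$ for all $1\le k\le r-1$; vertices may repeat and $v=w$ is allowed. It is odd (even) if its length is odd (even). *)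

(* Defs.v *)
From HB Require Import structures.
From mathcomp Require Import all_boot all_order all_algebra.
From mathcomp Require Import mpoly.

Set Implicit Arguments.
Unset Strict Implicit.
Unset Printing Implicit Defensive.

Import GRing.Theory.
Local Open Scope ring_scope.

(* Ideals are Prop-valued predicates, since membership in a generated ideal
   is not boolean for an abstract coefficient field. *)
Section Ideals.
Variable R : comNzRingType.
Implicit Types (S I : R -> Prop) (f p : R).

Definition ideal_gen S p : Prop :=
  exists s : seq (R * R),
    (forall c, c \in s -> S c.2) /\ p = \sum_(c <- s) c.1 * c.2.

(* I : f^oo, the union over m of the colon ideals I : f^m. *)
Definition saturation I f p : Prop := exists m : nat, I (p * f ^+ m).

End Ideals.

Section Walks.
Variables (V : finType) (e : rel V).

(* The walk is i :: s; its number of edges is size s, so the empty s is the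
   even walk of length 0 from i to itself. *)
Definition is_walk (i j : V) (s : seq V) : Prop := path e i s /\ last i s = j.

Definition has_odd_walk (i j : V) : Prop :=
  exists s, is_walk i j s /\ odd (size s).

Definition has_even_walk (i j : V) : Prop :=
  exists s, is_walk i j s /\ ~~ odd (size s).

End Walks.

Section GraphIdeals.
Variables (k : fieldType) (V : finType) (e : rel V).

(* The polynomial ring k[x_i, y_i : i in V]: the first #|V| indeterminates are
   the x_i, the last #|V| are the y_i. *)
Definition polyxy := {mpoly k[#|V| + #|V|]}.

Definition xvar (i : V) : polyxy := 'X_(lshift #|V| (enum_rank i)).
Definition yvar (i : V) : polyxy := 'X_(rshift #|V| (enum_rank i)).

Definition I_G : polyxy -> Prop :=
  ideal_gen (fun g => exists i j : V,
    e i j /\ g = xvar i * xvar j - yvar i * yvar j).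

Definition J_G : polyxy -> Prop :=
  saturation I_G (\prod_(i : V) (xvar i * yvar i)).

Definition walk_binomial (g : polyxy) : Prop :=
  (exists i j : V, has_odd_walk e i j /\
     g = xvar i * xvar j - yvar i * yvar j) \/
  (exists i j : V, has_even_walk e i j /\
     g = xvar i * yvar j - xvar j * yvar i).

End GraphIdeals.

(* Main.v *)
Require Import Defs.
From mathcomp Require Import all_boot all_order all_algebra.
From mathcomp Require Import mpoly.
From mathcomp Require Import bigenough ssrcomplements ring.

(** Write W for the ideal generated by the walk binomials.

    W is contained in the saturation J_G.  Modulo J_G every variable may be
    cancelled, so it suffices to derive, up to a factor x_l, the binomial of a
    walk i, l, ..., j from the edge binomial of {i, l} and the binomial of the
    shorter walk l, ..., j.  This is one identity, the same for both parities
    (binom_J_G).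

    Conversely W contains I_G, so it suffices that W is already saturated.
    This cannot rest on W being prime or radical: when G is not bipartite and
    the characteristic is 2, W contains (x_i - y_i)^2 but not x_i - y_i.
    Instead, W is recognized as the ideal of a grading.  Suppose that the
    monomials are sorted into classes so that multiplication by a monomial
    neither merges nor splits classes, that each generator is a difference of
    two monomials of one class, and that W contains all such differences.
    Then p is in W exactly when the coefficients of p add up to zero on each
    class (ideal_gen_class_sum).  Multiplication by a monomial only shifts the
    coefficients to another class, so monomials are nonzerodivisors modulo W
    (ideal_gen_saturated).

    For the walk binomials the classes come from a colouring of the vertices.
    By connectedness there is a map c from V to the booleans such that either
    (G bipartite) every walk from i to j has parity c i + c j, or (G not
    bipartite) walks of both parities join any two vertices (walk_parity).
    Exchange x_i and y_i at the vertices with c i = true, and call the two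
    variables at i then F_i and T_i.  In these variables W is generated by
    the F_i T_j - T_i F_j, together with the F_i F_j - T_i T_j if G is not
    bipartite.  The class of a monomial is its degree at each vertex, together
    with the number of variables T in it, counted modulo 2 if G is not
    bipartite.  The exchanges move all the T to the front of a word whose
    vertices are kept fixed, and the second family removes them in pairs, so
    that two monomials of one class reduce to the same word
    (word_cong_class). *)

Set Implicit Arguments.
Unset Strict Implicit.
Unset Printing Implicit Defensive.

Import GRing.Theory BigEnough.
Local Open Scope ring_scope.

(** * Generated ideals and saturations *)

Section IdealTheory.
Variable R : comNzRingType.
Implicit Types (S T : R -> Prop) (f g h p q : R).

Lemma ideal_gen_mem S p : S p -> ideal_gen S p.
Proof.
move=> Sp; exists [:: (1, p)]; split; first by move=> c; rewrite inE => /eqP ->.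
by rewrite big_seq1 mul1r.
Qed.

Lemma ideal_gen0 S : ideal_gen S 0.
Proof. by exists [::]; split=> //; rewrite big_nil. Qed.

Lemma ideal_genD S p q : ideal_gen S p -> ideal_gen S q -> ideal_gen S (p + q).
Proof.
move=> [s [Ss ->]] [t [St ->]]; exists (s ++ t); split; last by rewrite big_cat.
by move=> c; rewrite mem_cat => /orP[/Ss|/St].
Qed.

Lemma ideal_genM S a p : ideal_gen S p -> ideal_gen S (a * p).
Proof.
move=> [s [Ss ->]]; exists [seq (a * c.1, c.2) | c <- s]; split.
  by move=> _ /mapP[c /Ss Sc ->].
by rewrite big_map mulr_sumr; apply: eq_bigr => c _; rewrite mulrA.
Qed.

Lemma ideal_genN S p : ideal_gen S p -> ideal_gen S (- p).
Proof. by rewrite -mulN1r; apply: ideal_genM. Qed.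

Lemma ideal_gen_sum S (I : Type) (r : seq I) (P : pred I) (F : I -> R) :
  (forall i, P i -> ideal_gen S (F i)) -> ideal_gen S (\sum_(i <- r | P i) F i).
Proof.
by move=> SF; apply: big_ind => //; [apply: ideal_gen0 | apply: ideal_genD].
Qed.

Lemma ideal_gen_ind S (P : R -> Prop) :
  P 0 -> (forall p q, P p -> P q -> P (p + q)) ->
  (forall a g, S g -> P (a * g)) -> forall p, ideal_gen S p -> P p.
Proof.
move=> P0 PD PM p [s [Ss ->]]; rewrite big_seq.
by apply: big_ind => // c /Ss; apply: PM.
Qed.

Lemma ideal_gen_sub S T p :
  (forall g, S g -> ideal_gen T g) -> ideal_gen S p -> ideal_gen T p.
Proof.
move=> ST; apply: ideal_gen_ind; [exact: ideal_gen0 | exact: ideal_genD |].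
by move=> a g /ST; apply: ideal_genM.
Qed.

Lemma saturation_id S f p : ideal_gen S p -> saturation (ideal_gen S) f p.
Proof. by exists 0%N; rewrite mulr1. Qed.

Lemma saturationD S f p q : saturation (ideal_gen S) f p ->
  saturation (ideal_gen S) f q -> saturation (ideal_gen S) f (p + q).
Proof.
move=> [m Sp] [n Sq]; exists (m + n)%N; rewrite exprD mulrDl.
apply: ideal_genD; last by rewrite mulrCA; apply: ideal_genM.
by rewrite mulrA mulrC; apply: ideal_genM.
Qed.

Lemma saturationM S f a p :
  saturation (ideal_gen S) f p -> saturation (ideal_gen S) f (a * p).
Proof. by move=> [m Sp]; exists m; rewrite -mulrA; apply: ideal_genM. Qed.

(** A divisor of f acts as a nonzerodivisor modulo the saturation at f: the
    missing cofactor is supplied by one more power of f. *)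
Lemma saturation_cancel S f g h p : g * h = f ->
  saturation (ideal_gen S) f (g * p) -> saturation (ideal_gen S) f p.
Proof.
move=> <- [m Sp]; exists m.+1; rewrite exprS.
have -> : p * (g * h * (g * h) ^+ m) = h * (g * p * (g * h) ^+ m) by ring.
exact: ideal_genM.
Qed.

End IdealTheory.

(** * Binomial ideals spanned by the classes of a grading *)

Section GradedBinomialIdeals.
Variables (n : nat) (k : comNzRingType) (D : eqType) (cls : 'X_{1..n} -> D).
Implicit Types (p q : {mpoly k[n]}) (m a b : 'X_{1..n}) (c : D).

Definition class_sum c p : k := \sum_(m <- msupp p | cls m == c) p@_m.

(** Summing over all monomials of bounded degree replaces the support of p by
    a range that does not vary with p, which makes linearity visible. *)
Lemma class_sumE c p d : (msize p <= d)%N ->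
  class_sum c p = \sum_(m : 'X_{1..n < d} | cls m == c) p@_m.
Proof.
move=> le_pd; set I : subFinType _ := 'X_{1..n < d}.
rewrite /class_sum big_mkcond (big_mksub I) ?msupp_uniq //=; first last.
  by move=> x /msize_mdeg_lt /leq_trans; apply.
rewrite big_rmcond /= => [|j /memN_msupp_eq0 ->]; last by case: ifP.
by rewrite [RHS]big_mkcond.
Qed.

Lemma class_sum0 c : class_sum c 0 = 0.
Proof. by rewrite /class_sum msupp0 big_nil. Qed.

Lemma class_sumD c p q : class_sum c (p + q) = class_sum c p + class_sum c q.
Proof.
pose_big_enough d.
  rewrite !(@class_sumE _ _ d) // -big_split; apply: eq_bigr => m _.
  exact: mcoeffD.
by close.
Qed.

Lemma class_sumZ c x p : class_sum c (x *: p) = x * class_sum c p.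
Proof.
pose_big_enough d.
  rewrite !(@class_sumE _ _ d) // mulr_sumr; apply: eq_bigr => m _.
  exact: mcoeffZ.
by close.
Qed.

Lemma class_sumX c m : class_sum c 'X_[m] = (cls m == c)%:R.
Proof.
rewrite /class_sum msuppX big_mkcond big_seq1 mcoeffX eqxx.
by case: (cls m == c).
Qed.

Hypothesis cls_can : forall a b m, (cls (m + a)%MM == cls (m + b)%MM) = (cls a == cls b).

Lemma class_sumMX m a p : class_sum (cls (m + a)%MM) (p * 'X_[m]) = class_sum (cls a) p.
Proof.
rewrite /class_sum (perm_big _ (msuppMX p m)) big_map /=.
by apply: eq_big => [b|b _]; rewrite ?cls_can // mcoeffMX.
Qed.

Variable S : {mpoly k[n]} -> Prop.
Hypothesis S_homog :
  forall g, S g -> exists a b, cls a = cls b /\ g = 'X_[a] - 'X_[b].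
Hypothesis S_full :
  forall a b, cls a = cls b -> ideal_gen S ('X_[k, a] - 'X_[b]).

(** The class sums vanish on W because a generator times a monomial is again a
    difference of two monomials of one class.  Conversely, replacing each
    monomial of p by a representative of its class changes p by an element of
    W, and the result has the class sums of p as its coefficients. *)
Lemma ideal_gen_class_sum p : ideal_gen S p <-> forall m, class_sum (cls m) p = 0.
Proof.
split=> [Sp m|p0].
  elim/ideal_gen_ind: p / Sp => [|p q p0 q0|p g /S_homog[a [b [ab ->]]]].
  - exact: class_sum0.
  - by rewrite class_sumD p0 q0 addr0.
  rewrite [p]mpolyE mulr_suml.
  apply: (big_ind (fun q => class_sum (cls m) q = 0)); first exact: class_sum0.
    by move=> q r q0 r0; rewrite class_sumD q0 r0 addr0.
  move=> l _; rewrite -scalerAl class_sumZ mulrBr -!mpolyXD -scaleN1r.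
  have /eqP E : cls (l + a)%MM == cls (l + b)%MM by rewrite cls_can ab.
  by rewrite class_sumD class_sumZ !class_sumX E mulN1r subrr mulr0.
pose I := 'X_{1..n < msize p}.
pose rep (m : I) : I := odflt m [pick m' : I | cls m' == cls m].
have cls_rep (m : I) : cls (rep m) = cls m.
  by rewrite /rep; case: pickP => [m' /eqP|].
have rep_eq (m m' : I) : cls m = cls m' -> rep m = rep m'.
  move=> E; rewrite /rep (eq_pick (Q := fun l : I => cls l == cls m')) => [|l].
    by case: pickP => // /(_ m'); rewrite eqxx.
  by rewrite E.
rewrite (mpolywE (leqnn (msize p))).
have -> : \sum_(m : I) p@_m *: 'X_[m] =
    \sum_(m : I) (p@_m)%:MP * ('X_[k, m] - 'X_[rep m]).
  (* The representatives carry the class sums, hence cancel. *)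
  suff: \sum_(m : I) p@_m *: 'X_[k, rep m] = 0.
    move=> E; rewrite -[LHS]subr0 -[X in _ - X]E -sumrB.
    by apply: eq_bigr => m _; rewrite mul_mpolyC scalerBr.
  rewrite (partition_big rep predT) //= big1 // => j _.
  under eq_bigr => m /eqP -> do [].
  rewrite -scaler_suml; case: (pickP (fun m : I => rep m == j)) => [m /eqP mj|none].
    suff -> : \sum_(m : I | rep m == j) p@_m = class_sum (cls j) p.
      by rewrite p0 scale0r.
    rewrite (class_sumE _ (leqnn _)); apply: eq_bigl => l.
    apply/eqP/eqP => [<-|lj]; first by rewrite cls_rep.
    by rewrite -mj; apply: rep_eq; rewrite lj -mj cls_rep.
  by rewrite big_pred0 ?scale0r.
by apply: ideal_gen_sum => m _; apply/ideal_genM/S_full; rewrite cls_rep.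
Qed.

Lemma ideal_gen_saturated m p : ideal_gen S (p * 'X_[m]) -> ideal_gen S p.
Proof.
by rewrite !ideal_gen_class_sum => p0 a; rewrite -(class_sumMX m).
Qed.

End GradedBinomialIdeals.

(** * Parities of walks and the colouring of the vertices *)

Section WalkParity.
Variables (V : finType) (e : rel V).
Implicit Types (b : bool) (i j l : V).

Definition walk b i j : Prop := exists s, is_walk e i j s /\ odd (size s) = b.

Lemma walk_refl i : walk false i i.
Proof. by exists [::]. Qed.

Lemma walk_edge i j : e i j -> walk true i j.
Proof. by move=> ij; exists [:: j]; rewrite /is_walk /= ij. Qed.

Lemma walk_trans b b' i j l : walk b i j -> walk b' j l -> walk (b (+) b') i l.
Proof.
move=> [s [[ps <-] <-]] [t [[pt <-] <-]]; exists (s ++ t).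
by rewrite /is_walk cat_path last_cat ps pt size_cat oddD.
Qed.

(** Induction on walks by their first edge, with the length forgotten except
    for its parity. *)
Lemma walk_ind (P : bool -> V -> V -> Prop) :
  (forall i, P false i i) ->
  (forall b i l j, e i l -> walk b l j -> P b l j -> P (~~ b) i j) ->
  forall b i j, walk b i j -> P b i j.
Proof.
move=> P0 PS b i j [s [[]]].
elim: s b i => [|l s IHs] b i /=; first by move=> _ -> <-.
case/andP=> il ps sj <-; apply: (PS _ _ _ _ il); last exact: IHs.
by exists s.
Qed.

Hypothesis e_sym : ssrbool.symmetric e.

Lemma walk_sym b i j : walk b i j -> walk b j i.
Proof.
elim/walk_ind => {b i j} [i|b i l j il _ jl]; first exact: walk_refl.
by rewrite -addbT; apply: walk_trans jl _; apply: walk_edge; rewrite e_sym.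
Qed.

(** A walk of parity b from i to j is a path in the bipartite double cover from
    (i, c) to (j, c + b).  As reachability in a finite graph is decidable, so
    is the existence of a walk of a given parity, from which the colouring
    below is computed. *)
Definition double_cover : rel (V * bool) := fun u v => e u.1 v.1 && (u.2 != v.2).

Lemma walkP b i j : reflect (walk b i j) (connect double_cover (i, false) (j, b)).
Proof.
apply: (iffP idP) => [|w].
  suff H u v : connect double_cover u v -> walk (u.2 (+) v.2) u.1 v.1.
    exact: (H (i, false) (j, b)).
  case/connectP=> s; elim: s u => [|w s IHs] u /=.
    by move=> _ ->; rewrite addbb; apply: walk_refl.
  case/andP=> /andP[uw n_uw] ps vE.
  have -> : u.2 (+) v.2 = true (+) (w.2 (+) v.2).
    by move: n_uw; case: (u.2); case: (w.2); case: (v.2).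
  by apply: walk_trans (walk_edge uw) (IHs _ ps vE).
suff H c : connect double_cover (i, c) (j, c (+) b) by exact: (H false).
elim/walk_ind: w c => {b i j} [i|b i l j il _ IH] c; first by rewrite addbF.
apply: (connect_trans (connect1 (y := (l, ~~ c)) _)).
  by rewrite /double_cover /= il; case: c.
by rewrite addbN -addNb.
Qed.

Hypothesis G_connected : forall u v, connect e u v.

Lemma walk_exists i j : exists b, walk b i j.
Proof.
have /connectP[s ps ->] := G_connected i j.
by exists (odd (size s)), s.
Qed.

(** The boolean bip says that there is no odd closed walk.  If there is one at
    some v, then a detour through v changes the parity of any walk, and c is
    arbitrary.  If there is none, then all walks from a root r to j have one
    parity, and this is c j. *)
Lemma walk_parity : exists (bip : bool) (c : V -> bool),
  forall b i j, walk b i j <-> (bip -> b = c i (+) c j).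
Proof.
case: (pickP (@predT V)) => [r _|V0]; last first.
  by exists true, (fun=> true) => b i; have := V0 i.
exists (~~ [exists v, connect double_cover (v, false) (v, true)]).
exists (fun j => connect double_cover (r, false) (j, true)) => b i j.
case: existsP => [[v /walkP vv]|no_odd] /=.
  split=> // _; have [b1 iv] := walk_exists i v; have [b2 vj] := walk_exists v j.
  (* Two walks from i to j, with and without the odd closed walk at v. *)
  have odd_or_even := walk_trans iv (walk_trans vv vj).
  have := walk_trans iv vj.
  by case: b b1 b2 odd_or_even {iv vj} => -[] [].
have colour l c : walk c r l -> connect double_cover (r, false) (l, true) = c.
  case: c => rl; first exact/walkP.
  apply/negP=> /walkP rl'; apply: no_odd; exists r; apply/walkP.
  exact: (walk_trans rl' (walk_sym rl)).
have [c ri] := walk_exists r i; rewrite (colour _ _ ri).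
split=> [ij _|/(_ isT) ->].
  by rewrite (colour _ _ (walk_trans ri ij)) addKb.
have [d rj] := walk_exists r j; rewrite (colour _ _ rj).
exact: (walk_trans (walk_sym ri) rj).
Qed.

End WalkParity.

(** * The walk binomials lie in the saturation *)

Section WalkIdeal.
Variables (k : fieldType) (V : finType) (e : rel V).
Implicit Types (b c : bool) (i j l : V).

Definition letter i b : 'I_(#|V| + #|V|) :=
  if b then rshift #|V| (enum_rank i) else lshift #|V| (enum_rank i).

Definition var i b : polyxy k V := 'X_(letter i b).

(** One formula for both families: up to the order of factors, b = true gives
    the binomial of an odd walk and b = false that of an even one. *)
Definition binom i j b : polyxy k V :=
  var i false * var j (~~ b) - var i true * var j b.

Lemma walk_binomialP g :
  walk_binomial e g <-> exists i j b, walk e b i j /\ g = binom i j b.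
Proof.
split=> [[]|[i [j [[] [w ->]]]]].
- by move=> [i [j [[s [ws os]] ->]]]; exists i, j, true; split=> //; exists s.
- move=> [i [j [[s [ws os]] ->]]]; exists i, j, false; split.
    by exists s; rewrite (negbTE os).
  by rewrite /binom [X in _ - X]mulrC.
- by left; exists i, j; split=> //; case: w => s [ws os]; exists s.
right; exists i, j; split; first by case: w => s [ws os]; exists s; rewrite os.
by rewrite /binom [X in _ - X]mulrC.
Qed.

Lemma binom_edge_mem i j : e i j -> I_G e (binom i j true).
Proof. by move=> ij; apply: ideal_gen_mem; exists i, j. Qed.

Lemma J_G_cancel i b p : J_G e (var i b * p) -> J_G e p.
Proof.
apply: (@saturation_cancel _ _ _ _
  (var i (~~ b) * \prod_(j | j != i) (xvar k j * yvar k j))).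
rewrite [RHS](bigD1 i) //= mulrA; congr (_ * _).
by case: b; rewrite // mulrC.
Qed.

(** Induction on the walk.  With l the second vertex, x_l times the binomial of
    the walk is a combination of the edge binomial of {i, l} and the binomial
    of the remaining walk, and x_l cancels modulo J_G. *)
Lemma binom_J_G b i j : walk e b i j -> J_G e (binom i j b).
Proof.
elim/walk_ind => {b i j} [i|b i l j il _ lj].
  rewrite /binom [X in _ - X]mulrC subrr.
  exact/saturation_id/ideal_gen0.
apply: (@J_G_cancel l false).
have -> : var l false * binom i j (~~ b) =
    var j b * binom i l true + (- var i true) * binom l j b.
  by rewrite /binom negbK /=; ring.
apply: saturationD; apply: saturationM => //.
exact/saturation_id/binom_edge_mem.
Qed.


(** * The grading of the walk ideal *)

Variables (c : V -> bool) (bip : bool).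
Hypothesis parity : forall b i j, walk e b i j <-> (bip -> b = c i (+) c j).

Notation W := (ideal_gen (@walk_binomial k V e)).
Implicit Types (w : seq (V * bool)) (s : seq V) (d : bool) (t : nat).

(** Exchanging x_i and y_i where c i holds turns the binomials given by the
    colouring into the 2-minors of a generic matrix with two rows. *)
Definition tletter i b := letter i (b (+) c i).
Definition tvar i b : polyxy k V := var i (b (+) c i).

(** Up to sign these are walk binomials. For d = false they are the 2-minors;
    for d = true, present when G is not bipartite, they trade a product of
    two false variables for the product of the corresponding true ones. *)
Lemma twisted_binomial d i j : (bip -> d = false) ->
  W (tvar i false * tvar j (~~ d) - tvar i true * tvar j d).
Proof.
move=> bip_d; have : W (binom i j (d (+) c i (+) c j)).
  apply/ideal_gen_mem/walk_binomialP; do 3!eexists; split; last by [].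
  by apply/parity => /bip_d ->.
rewrite /binom /tvar; case: (c i); last by case: d {bip_d}; case: (c j).
move/ideal_genN; rewrite opprB.
by case: d {bip_d}; case: (c j).
Qed.

(** Monomials are handled as words of pairs (vertex, boolean), because the
    reductions exchange the booleans and leave the sequence of vertices as it
    is. *)
Definition word_prod w : polyxy k V := \prod_(x <- w) tvar x.1 x.2.
Definition word_cong w w' := W (word_prod w - word_prod w').

Lemma word_cong_refl w : word_cong w w.
Proof. by rewrite /word_cong subrr; apply: ideal_gen0. Qed.

Lemma word_cong_sym w w' : word_cong w w' -> word_cong w' w.
Proof. by move/ideal_genN; rewrite opprB. Qed.

Lemma word_cong_trans w1 w2 w3 :
  word_cong w1 w2 -> word_cong w2 w3 -> word_cong w1 w3.
Proof.
by move=> W12 W23; move: (ideal_genD W12 W23); rewrite addrA subrK.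
Qed.

Lemma word_cong_cons x w w' : word_cong w w' -> word_cong (x :: w) (x :: w').
Proof.
by rewrite /word_cong /word_prod !big_cons -mulrBr; apply: ideal_genM.
Qed.

Lemma word_cong_pair d i j w : (bip -> d = false) ->
  word_cong ((i, false) :: (j, ~~ d) :: w) ((i, true) :: (j, d) :: w).
Proof.
move=> bip_d; rewrite /word_cong /word_prod !big_cons !mulrA -mulrBl mulrC.
exact/ideal_genM/twisted_binomial.
Qed.

(** The normal form of the words over s in which t booleans are true: the true
    ones come first. *)
Fixpoint fill s t : seq (V * bool) :=
  if s is i :: s' then (i, 0 < t)%N :: fill s' t.-1 else [::].

(** A false boolean in front trades places with the first true one, and moves
    on to the right in this way until no true boolean follows it. *)
Lemma fill_push i s t : (t <= size s)%N ->
  word_cong ((i, false) :: fill s t) (fill (i :: s) t).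
Proof.
elim: s i t => [|j s IHs] i [|t] //= le_ts; try exact: word_cong_refl.
apply: (@word_cong_trans _ ((i, true) :: (j, false) :: fill s t)).
  exact: (@word_cong_pair false).
exact/word_cong_cons/IHs.
Qed.

Lemma word_cong_fill w :
  word_cong w (fill (map fst w) (count snd w)).
Proof.
elim: w => [|[i b] w IHw] /=; first exact: word_cong_refl.
apply: (word_cong_trans (word_cong_cons (i, b) IHw)).
case: b => /=; first exact: word_cong_refl.
by apply: fill_push; rewrite size_map count_size.
Qed.

(** The last two true booleans of the normal form are adjacent, so the binomials
    of the second family turn them into false ones. *)
Lemma fill_parity s t : ~~ bip -> (t.+2 <= size s)%N ->
  word_cong (fill s t.+2) (fill s t).
Proof.
move=> nbip; elim: t s => [|t IHt] [|i s] //= le_ts; last exact/word_cong_cons/IHt.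
case: s le_ts => [|j s] //= _; apply: word_cong_sym.
by apply: (@word_cong_pair true); rewrite (negPf nbip).
Qed.

Definition count_class t : nat := if bip then t else odd t.

Lemma fill_class s t : (t <= size s)%N ->
  word_cong (fill s t) (fill s (count_class t)).
Proof.
rewrite /count_class; case: ifPn => [_ _|nbip]; first exact: word_cong_refl.
elim/ltn_ind: t => -[|[|t]] IHt le_ts; try exact: word_cong_refl.
apply: (word_cong_trans (fill_parity nbip le_ts)).
rewrite /= negbK; apply: IHt => //.
by rewrite (leq_trans _ le_ts) // !leqW.
Qed.

Lemma word_cong_class w w' :
  map fst w = map fst w' ->
  count_class (count snd w) = count_class (count snd w') -> word_cong w w'.
Proof.
move=> sw cw.
apply: (word_cong_trans (word_cong_fill w)).
apply: word_cong_trans (word_cong_sym (word_cong_fill w')).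
rewrite -sw; apply: (@word_cong_trans _ (fill (map fst w) (count_class (count snd w)))).
  by apply: fill_class; rewrite size_map count_size.
rewrite cw; apply/word_cong_sym/fill_class.
by rewrite sw size_map count_size.
Qed.

Implicit Types (m a : 'X_{1.. #|V| + #|V|}).

Definition mdeg_at m i := (m (tletter i false) + m (tletter i true))%N.
Definition true_count m := (\sum_i m (tletter i true))%N.
(** The first component is a finite function, so that equality of classes is
    decidable. *)
Definition cls m := ([ffun i => mdeg_at m i], count_class (true_count m)).

(** A word for m which lists the vertices in a fixed order: words of monomials
    with the same degree at each vertex then have the same vertex sequence, and
    no permutation of words is ever needed. *)
Definition mword m : seq (V * bool) := flatten
  [seq nseq (m (tletter i false)) (i, false) ++ nseq (m (tletter i true)) (i, true)
  | i <- index_enum V].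

Lemma mword_fst m :
  map fst (mword m) = flatten [seq nseq (mdeg_at m i) i | i <- index_enum V].
Proof.
rewrite map_flatten -map_comp; congr flatten; apply: eq_map => i /=.
by rewrite map_cat !map_nseq /mdeg_at nseqD.
Qed.

Lemma mword_count m : count snd (mword m) = true_count m.
Proof.
rewrite count_flatten sumnE !big_map; apply: eq_bigr => i _.
by rewrite count_cat !count_nseq /= mul0n mul1n.
Qed.

Lemma mword_prod m : word_prod (mword m) = 'X_[m].
Proof.
rewrite /word_prod big_flatten big_map mpolyXE_id big_split_ord /=.
rewrite -big_split /= [RHS](reindex enum_rank) /=; last exact/onW_bij/enum_rank_bij.
apply: eq_bigr => i _; rewrite big_cat /= !big_nseq !iter_mulr_1 /=.
by rewrite /tvar /var /tletter /letter; case: (c i); rewrite //= mulrC.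
Qed.

Lemma class_full a m : cls a = cls m -> W ('X_[k, a] - 'X_[m]).
Proof.
case=> /ffunP deg_am cnt_am; rewrite -2!mword_prod.
apply: word_cong_class; last by rewrite !mword_count.
rewrite !mword_fst; congr flatten; apply: eq_map => i.
by have := deg_am i; rewrite !ffunE => ->.
Qed.

Lemma true_countD m a : true_count (m + a)%MM = (true_count m + true_count a)%N.
Proof. by rewrite -big_split; apply: eq_bigr => i _; rewrite mnmDE. Qed.

Lemma mdeg_atD m a i : mdeg_at (m + a)%MM i = (mdeg_at m i + mdeg_at a i)%N.
Proof. by rewrite /mdeg_at !mnmDE addnACA. Qed.

Lemma count_class_can r t t' :
  (count_class (r + t) == count_class (r + t')) = (count_class t == count_class t').
Proof.
rewrite /count_class; case: bip; first exact: eqn_add2l.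
by rewrite !oddD; case: (odd r); case: (odd t); case: (odd t').
Qed.

Lemma cls_can a a' m : (cls (m + a)%MM == cls (m + a')%MM) = (cls a == cls a').
Proof.
rewrite !xpair_eqE !true_countD count_class_can; congr (_ && _).
apply/eqP/eqP=> /ffunP E; apply/ffunP => i; have := E i; rewrite !ffunE !mdeg_atD.
  exact: addnI.
by move=> ->.
Qed.

Lemma eq_letter i j b d : (letter i b == letter j d) = (i == j) && (b == d).
Proof.
rewrite /letter; case: b; case: d; rewrite ?andbT ?andbF.
- by rewrite eq_rshift (inj_eq enum_rank_inj).
- exact: eq_rlshift.
- exact: eq_lrshift.
- by rewrite eq_lshift (inj_eq enum_rank_inj).
Qed.

Lemma mdeg_at_letter i b j : mdeg_at U_(letter i b) j = (i == j).
Proof.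
rewrite /mdeg_at !mnm1E !eq_letter; case: (i == j) => //.
by case: b; case: (c j).
Qed.

Lemma true_count_letter i b : true_count U_(letter i b) = (b (+) c i).
Proof.
rewrite /true_count (bigD1 i) //= big1 => [|j /negPf ji]; last first.
  by rewrite mnm1E eq_letter eq_sym ji.
by rewrite mnm1E eq_letter eqxx addn0; case: b; case: (c i).
Qed.

(** When G is bipartite, each of the two monomials contains exactly one true
    variable; otherwise only the parities of the two counts agree. *)
Lemma walk_binomial_homog (g : polyxy k V) : walk_binomial e g ->
  exists a m, cls a = cls m /\ g = 'X_[a] - 'X_[m].
Proof.
case/walk_binomialP => i [j [b [/parity w ->]]].
exists (U_(letter i false) + U_(letter j (~~ b)))%MM.
exists (U_(letter i true) + U_(letter j b))%MM.
split; last by rewrite !mpolyXD.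
rewrite /cls !true_countD !true_count_letter; congr (_, _).
  by apply/ffunP=> l; rewrite !ffunE !mdeg_atD !mdeg_at_letter.
rewrite /count_class; move: w; case: bip => w.
  by rewrite w //; case: (c i); case: (c j).
by rewrite !oddD !oddb; case: b {w}; case: (c i); case: (c j).
Qed.

Lemma xy_monomial : exists m, \prod_(i : V) (xvar k i * yvar k i) = 'X_[m].
Proof.
exists (\sum_(i : V) (U_(letter i false) + U_(letter i true)))%MM.
by rewrite -mprodXE; apply: eq_bigr => i _; rewrite mpolyXD.
Qed.

(** A power of the product of all variables is a monomial, and I_G is contained
    in the walk ideal, for which monomials are nonzerodivisors. *)
Lemma J_G_walk_ideal p : J_G e p -> W p.
Proof.
case=> r Ip; have [m xyE] := xy_monomial; move: Ip; rewrite xyE mpolyXn => Ip.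
apply: (ideal_gen_saturated cls_can walk_binomial_homog class_full (m := (m *+ r)%MM)).
apply: ideal_gen_sub Ip => g [i [j [ij ->]]].
apply/ideal_gen_mem/walk_binomialP; exists i, j, true.
by split; first exact: walk_edge.
Qed.

End WalkIdeal.

Theorem proposition2p7 (k : fieldType) (V : finType) (e : rel V)
  (e_sym : ssrbool.symmetric e) (e_irr : irreflexive e)
  (G_connected : forall u v : V, connect e u v)
  (p : polyxy k V) :
  J_G e p <-> ideal_gen (@walk_binomial k V e) p.
Proof.
have [bip [c parity]] := walk_parity e_sym G_connected.
split=> [|Wp]; first exact: (J_G_walk_ideal parity).
elim/ideal_gen_ind: p / Wp => [|p q|a g /walk_binomialP[i [j [b [w ->]]]]].
- exact/saturation_id/ideal_gen0.
- exact: saturationD.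
exact/saturationM/binom_J_G.
Qed.
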